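(* Consider the first-to-reach-$n$ game driven by a P\'olya urn with initially $N_1\ge 1$ balls of type 1 and $N_2\ge 1$ balls of type 2 ($N_1,N_2$ integers). For fixed $N_1,N_2\ge1$, as the target level $n\to\infty$, $$\mathbb{P}(\text{Player 1 wins overall})\to\frac{\Gamma(N_1+N_2)}{\Gamma(N_1)\Gamma(N_2)}\int_0^1\frac{(1-x)^{N_2-1}}{(2-x)^{N_1+N_2}}\,dx.$$
   Context: P\'olya model: an urn initially contains $N_i$ balls of type $i$, $i=1,2$. At each round a ball is drawn uniformly at random from the urn and returned together with one additional ball of the same type. If the drawn ball is of type $i$, Player $i$ wins the round. The game stops the first time one of the players has won exactly $n$ rounds (the target level), and that player is the overall winner. *)

(* Defs.v *)
From mathcomp Require Import all_boot all_order all_algebra.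
From mathcomp Require Import all_classical all_reals all_analysis.
Set Implicit Arguments.
Unset Strict Implicit.
Unset Printing Implicit Defensive.
Import Order.TTheory GRing.Theory Num.Theory.
Import numFieldNormedType.Exports.
Local Open Scope classical_set_scope.
Local Open Scope ring_scope.

(** Euler's integral; the junk value outside [z > 0] is irrelevant here.
    At [t = 0] the convention [0 `^ 0 = 1] only affects a null set. *)
Definition Gamma (R : realType) (z : R) : R :=
  \int[lebesgue_measure]_(t in `[0, +oo[) (t `^ (z - 1) * expR (- t)).

(** A ball type, and the player who wins when it is drawn, is a boolean:
    [true] is type 1 / Player 1, [false] is type 2 / Player 2.
    Rounds are numbered from 0, and [X k w] is the type drawn at round [k]. *)

(** Number of balls of type [i] in the urn once the draws listed in [h] have
    been made, each of them having added one ball of the type drawn. *)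
Definition urn (N1 N2 : nat) (h : seq bool) (i : bool) : nat :=
  ((if i then N1 else N2) + count_mem i h)%N.

Definition history (Omega : Type) (X : nat -> Omega -> bool) (k : nat)
    (w : Omega) : seq bool :=
  mkseq (fun j => X j w) k.

(** Conditionally on any history [h] of past draws, the next ball is uniform
    among the balls in the urn.  The conditional probability is written in
    product form, P(A /\ B) = P(A) * P(B | A).  The draws are defined for all
    rounds: a game stopped at a finite round only looks at the earlier ones. *)
Definition polya_urn (R : realType) (d : measure_display)
    (Omega : measurableType d) (P : probability Omega R) (N1 N2 : nat)
    (X : nat -> {RV P >-> bool}) : Prop :=
  forall (h : seq bool) (i : bool),
    P [set w | history X (size h) w = h /\ X (size h) w = i] =
    (P [set w | history X (size h) w = h] *
      ((urn N1 N2 h i)%:R /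
       (urn N1 N2 h true + urn N1 N2 h false)%N%:R)%:E)%E.

(** Rounds won by player [i] among the first [k] rounds. *)
Definition wins (Omega : Type) (X : nat -> Omega -> bool) (i : bool)
    (k : nat) (w : Omega) : nat :=
  count_mem i (history X k w).

(** The game with target level [n] stops after [tau] rounds, [tau] being the
    first time some player has won exactly [n] of them. *)
Definition stops_at (Omega : Type) (X : nat -> Omega -> bool) (n tau : nat)
    (w : Omega) : Prop :=
  (exists i, wins X i tau w = n) /\
  (forall k i, (k < tau)%N -> wins X i k w <> n).

Definition wins_overall (Omega : Type) (X : nat -> Omega -> bool) (n : nat)
    (i : bool) : set Omega :=
  [set w | exists tau, stops_at X n tau w /\ wins X i tau w = n].

(* Main.v *)
Require Import Defs.
From mathcomp Require Import all_boot all_order all_algebra.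
From mathcomp Require Import all_classical all_reals all_analysis.
From mathcomp Require Import measurable_realfun zify ring lra.
Import Order.TTheory GRing.Theory Num.Theory.
Import numFieldNormedType.Exports.
Local Open Scope classical_set_scope.
Local Open Scope ring_scope.

(** The urn is a Beta(N1, N2) mixture of Bernoulli sequences (de Finetti): a
    history with [c] draws of type 1 and [c'] of type 2 has probability
    B(N1 + c, N2 + c') / B(N1, N2).  Player 1 reaches [n + 1] first exactly when
    they win a majority of the first [2 n + 1] rounds, so the winning
    probability is the Beta average of the probability [W n x] that heads have
    the majority in [2 n + 1] tosses of a coin of bias [x].  As [W n x] tends to
    the indicator of [x > 1/2], dominated convergence gives the Beta mass of
    [1/2, 1], and the substitution [x = 1 / (2 - y)] yields the stated form. *)

Lemma XMonemXE (R : numDomainType) a b (x : R) :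
  XMonemX a b x = x ^+ a * (1 - x) ^+ b.
Proof. by []. Qed.

(** * The Gamma function at positive integers *)

Section Gamma.
Variable R : realType.

(** One term of the exponential series, [t^(n+1) / (n+1)! <= expR t], bounds the product by
    [(n+1)! / t]. *)
Lemma expr_expRN_cvg0 n : (t ^+ n * expR (- t) : R) @[t --> +oo] --> 0.
Proof.
apply: (@squeeze_cvgr _ _ _ _ (fun=> 0) (fun t : R => n.+1`!%:R / t)).
- near=> t.
  have t0 : 0 < t by near: t; exact: nbhs_pinfty_gt.
  rewrite mulr_ge0 ?exprn_ge0 ?expR_ge0 ?(ltW t0)//= expRN.
  rewrite ler_pdivlMr// mulrAC -exprSr ler_pdivrMr ?expR_gt0//.
  rewrite mulrC -ler_pdivrMr ?ltr0n ?fact_gt0//.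
  by apply: le_trans (expR_ge1Dxn n (ltW t0)); rewrite lerDr.
- exact: cvg_cst.
- rewrite -[X in _ --> X](mulr0 (n.+1`!%:R : R)).
  apply: cvgM; first exact: cvg_cst.
  by apply/gtr0_cvgV0; [exact: nbhs_pinfty_gt|exact: cvg_id].
Unshelve. all: by end_near. Qed.

(** Antiderivative of [t^n e^(-t)] produced by repeated integration by parts; each recursive call
    lowers the power of [t] by one. *)
Fixpoint Gamma_primitive (n : nat) (t : R) : R :=
  - (t ^+ n * expR (- t)) +
  (if n is m.+1 then n%:R * Gamma_primitive m t else 0).

Lemma is_derive_Gamma_primitive n (t : R) :
  is_derive t 1 (Gamma_primitive n) (t ^+ n * expR (- t)).
Proof.
have dexp : is_derive t 1 (fun t : R => expR (- t)) (- expR (- t)).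
  rewrite -mulrN1; exact: is_derive1_comp.
elim: n => [|n IH].
  rewrite [Gamma_primitive 0](_ : _ = fun t => - expR (- t)); last first.
    by apply/funext => x /=; rewrite expr0 mul1r addr0.
  by apply: is_derive_eq; rewrite expr0 mul1r opprK.
rewrite [Gamma_primitive n.+1](_ : _ =
  (- ((@id R) ^+ n.+1 * (fun t : R => expR (- t)))
   + n.+1%:R \*: Gamma_primitive n)); last first.
  by apply/funext => x; rewrite /= exprfctE.
apply: is_derive_eq; rewrite /GRing.scale /=.
by rewrite exprfctE /=; ring.
Qed.

Lemma Gamma_primitive_cvgy n : Gamma_primitive n t @[t --> +oo] --> (0 : R).
Proof.
have expN m : - (t ^+ m * expR (- t) : R) @[t --> +oo] --> (0 : R).
  by rewrite -oppr0; apply: cvgN; exact: expr_expRN_cvg0.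
elim: n => [|n IH] /=; rewrite -[X in _ --> X](addr0 0); apply: cvgD => //.
  exact: cvg_cst.
by rewrite -[X in _ --> X](mulr0 n.+1%:R); apply: cvgM => //; exact: cvg_cst.
Qed.

Lemma Gamma_primitive0 n : Gamma_primitive n 0 = - n`!%:R :> R.
Proof.
elim: n => [|n /= ->]; rewrite /= oppr0 expR0.
  by rewrite expr0 mul1r addr0.
by rewrite exprS !mul0r oppr0 add0r factS natrM mulrN.
Qed.

(** The primitive tends to 0 at infinity and equals [- n!] at 0, so the fundamental theorem of
    calculus on the half-line gives the value. *)
Lemma Gamma_natS n : Gamma n.+1%:R = n`!%:R :> R.
Proof.
have dG t := is_derive_Gamma_primitive n t.
rewrite /Gamma.
under eq_Rintegral => t.
  rewrite inE/= in_itv/= andbT => t0.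
  rewrite -natr1 addrK powR_mulrn//.
  over.
rewrite (@Rintegral_ge0_continuous_FTC2y _ _ (Gamma_primitive n) _ 0).
- by rewrite Gamma_primitive0 sub0r opprK.
- by move=> t t0; rewrite mulr_ge0 ?exprn_ge0 ?expR_ge0.
- apply: continuous_subspaceT => t; apply: cvgM; first exact: exprn_continuous.
  by apply: continuous_comp; [exact: continuousN|exact: continuous_expR].
- exact: Gamma_primitive_cvgy.
- by move=> t _; have := dG t => -[].
- apply: cvg_at_right_filter; apply: differentiable_continuous.
  by apply/derivable1_diffP; have := dG 0 => -[].
- by move=> t _; rewrite derive1E; have := dG t => -[].
Qed.

End Gamma.

(** * The substitution on the upper half of the Beta integral *)

Section beta_half.
Variable R : realType.
Local Notation mu := (@lebesgue_measure R).

Lemma is_derive_two_sub_inv (x : R) : x < 2 ->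
  is_derive x 1 (fun y : R => (2 - y)^-1) ((2 - x) ^- 2).
Proof.
move=> x2; have h : 2 - x != 0 by rewrite subr_eq0 gt_eqF.
have d : is_derive x 1 (fun y : R => 2 - y) (-1).
  by rewrite -sub0r; apply: is_deriveB.
have := @is_deriveV _ (fun y : R => 2 - y) _ _ _ h d.
by rewrite scaleNr scalerN opprK /GRing.scale/= mulr1.
Qed.

(** Supplies the interior continuity and the endpoint limits of the derivative that the substitution
    rule asks for. *)
Lemma derive1_two_sub_inv_cvg (x : R) : x < 2 ->
  (fun y : R => (2 - y)^-1)^`()%classic y @[y --> x] --> (2 - x) ^- 2.
Proof.
move=> x2; apply: (@cvg_trans _ ((2 - y) ^- 2 @[y --> x])).
  apply: near_eq_cvg; near=> y.
  have y2 : y < 2 by near: y; exact: lt_nbhsl.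
  by rewrite derive1E; have [_ ->] := is_derive_two_sub_inv _ y2.
have := @cvgV R R (nbhs x) _ (fun y : R => (2 - y) ^+ 2) ((2 - x) ^+ 2); apply.
  by rewrite expf_neq0// subr_eq0 gt_eqF.
apply: (@continuous_comp _ _ _ (fun y : R => 2 - y) (fun y => y ^+ 2)).
  by apply: cvgB; [exact: cvg_cst|exact: cvg_id].
exact: exprn_continuous.
Unshelve. all: by end_near. Qed.

(** The increasing map [F y = 1 / (2 - y)] sends 0 to 1/2 and 1 to 1. Here
    [1 - F y = (1 - y) / (2 - y)] and [F' y = 1 / (2 - y)^2], which accounts for the two extra
    powers in the denominator. *)
Lemma integral_XMonemX_upper_half a b :
  \int[mu]_(x in `[2^-1, 1]) XMonemX a b x =
  \int[mu]_(x in `[0, 1]) ((1 - x) ^+ b / (2 - x) ^+ (a + b).+2).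
Proof.
pose F (y : R) := (2 - y)^-1.
have F0 : F 0 = 2^-1 by rewrite /F subr0.
have F1 : F 1 = 1 by rewrite /F -addrA subrr addr0 invr1.
have dF (x : R) : x < 2 -> derivable F x 1.
  by move=> /is_derive_two_sub_inv[].
have cF (x : R) : x < 2 -> F y @[y --> x] --> F x.
  by move=> x2; apply/differentiable_continuous/derivable1_diffP/dF.
rewrite /Rintegral -F0 -{1}F1 integration_by_substitution_increasing//.
- congr fine; apply: eq_integral => x; rewrite inE/= in_itv/= => /andP[x0 x1].
  have x2 : x < 2 by lra.
  transitivity (XMonemX a b (F x) * F^`()%classic x)%:E => //.
  rewrite derive1E; have [_ ->] := is_derive_two_sub_inv _ x2.
  have h : 2 - x != 0 by rewrite subr_eq0 gt_eqF.
  have -> : XMonemX a b (F x) = (2 - x)^-1 ^+ a * ((1 - x) / (2 - x)) ^+ b.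
    by rewrite XMonemXE /F; congr (_ * _ ^+ _); field.
  rewrite exprVn expr_div_n mulrCA -mulrA; congr (_ * _)%:E.
  by rewrite -!invfM -!exprD addn2.
- move=> x y; rewrite !in_itv/= => /andP[x0 x1] /andP[y0 y1] xy.
  by rewrite /F ltf_pV2 ?posrE; lra.
- move=> x; rewrite in_itv/= => /andP[x0 x1].
  have x2 : x < 2 by lra.
  have := derive1_two_sub_inv_cvg _ x2.
  by have [_ <-] := is_derive_two_sub_inv _ x2; rewrite -derive1E.
- apply/cvg_ex; eexists; apply: cvg_at_right_filter.
  by apply: derive1_two_sub_inv_cvg; lra.
- apply/cvg_ex; eexists; apply: cvg_at_left_filter.
  by apply: derive1_two_sub_inv_cvg; lra.
- split.
  + by move=> x; rewrite in_itv/= => /andP[x0 x1]; apply: dF; lra.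
  + by apply: cvg_at_right_filter; apply: cF; lra.
  + by apply: cvg_at_left_filter; apply: cF; lra.
- exact: within_continuous_XMonemX.
Qed.

End beta_half.

(** * Majority in an odd number of independent coin tosses *)

Section Bernoulli.
Variable R : realType.
Implicit Types (p : R) (n N : nat).

Lemma count_mem_bool (s : seq bool) :
  (count_mem true s + count_mem false s)%N = size s.
Proof. by elim: s => //= -[] s <-; lia. Qed.

Lemma XMonemX_count (s : seq bool) p :
  XMonemX (count_mem true s) (count_mem false s) p =
  \prod_(b <- s) (if b then p else 1 - p).
Proof.
elim: s => [|b s IH]; first by rewrite big_nil XMonemX00.
by rewrite big_cons -IH !XMonemXE; case: b => /=;
  rewrite ?add0n ?add1n ?exprS; ring.
Qed.

(** By distributivity the sum over all toss sequences factors into [N] copies of [p + (1 - p)]. *)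
Lemma sum_XMonemX_tuple N p :
  \sum_(t : N.-tuple bool) XMonemX (count_mem true t) (count_mem false t) p = 1.
Proof.
under eq_bigr do rewrite XMonemX_count big_tuple.
(* Tuples are traded for finite functions, over which a product of sums expands. *)
rewrite (reindex (@tuple_of_finfun bool N)) /=; last first.
  by exists (@finfun_of_tuple bool N) => t _;
    rewrite ?tuple_of_finfunK ?finfun_of_tupleK.
under eq_bigr => f _.
  under eq_bigr do rewrite tnth_mktuple.
  over.
rewrite -(bigA_distr_bigA (fun (i : 'I_N) b => if b then p else 1 - p)).
by apply: big1 => i _; rewrite big_bool/= subrKC.
Qed.

(** This is [W n x] of the overview, kept as a sum over toss sequences rather than binomially so
    that it matches the sum over urn histories. *)
Definition majority_prob n p : R :=
  \sum_(t : (n.*2.+1).-tuple bool | (n < count_mem true t)%N)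
    XMonemX (count_mem true t) (count_mem false t) p.

Lemma majority_prob_ge0 n p : p \in `[0, 1] -> 0 <= majority_prob n p.
Proof. by move=> p01; apply: sumr_ge0 => t _; exact: XMonemX_ge0. Qed.

(** Flipping every toss exchanges [p] with [1 - p] and, the number of tosses being odd, exchanges
    majority with its complement. *)
Lemma majority_prob_onem n p : majority_prob n (1 - p) = 1 - majority_prob n p.
Proof.
apply/eqP; rewrite eq_sym subr_eq; apply/eqP.
rewrite -[LHS](sum_XMonemX_tuple n.*2.+1 p).
rewrite (bigID (fun t : _.-tuple bool => (n < count_mem true t)%N)) /= addrC.
congr (_ + _).
pose f N (t : N.-tuple bool) := [tuple of map negb t].
have fK N : involutive (@f N).
  by move=> t; apply: val_inj; rewrite /= mapK//; exact: negbK.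
rewrite [RHS](reindex_inj (inv_inj (@fK _))) /=.
have cf N (t : N.-tuple bool) b : count_mem b (f N t) = count_mem (~~ b) t.
  by rewrite count_map; apply: eq_count => -[]; case: b.
apply: eq_big => [t|t _].
  by rewrite cf; have := count_mem_bool t; rewrite size_tuple /=; lia.
by rewrite !cf XMonemXC.
Qed.

Lemma majority_prob_le1 n p : p \in `[0, 1] -> majority_prob n p <= 1.
Proof.
move=> p01; rewrite -subr_ge0 -majority_prob_onem; apply: majority_prob_ge0.
by move: p01; rewrite !in_itv/= => /andP[]; lra.
Qed.

(** Each sequence with a majority of heads has weight at most [(p (1 - p))^n], and there are at most
    [2^(2n+1) = 2 * 4^n] of them. *)
Lemma majority_prob_le n p : 0 <= p <= 2^-1 ->
  majority_prob n p <= 2 * (4 * (p * (1 - p))) ^+ n.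
Proof.
move=> /andP[p0 p2].
have q0 : 0 <= 1 - p by lra.
have le t : t \in [pred t : (n.*2.+1).-tuple bool | (n < count_mem true t)%N] ->
    XMonemX (count_mem true t) (count_mem false t) p <= (p * (1 - p)) ^+ n.
  rewrite inE /= => nt; have := count_mem_bool t; rewrite size_tuple => ct.
  set c := count_mem true t in nt ct *; set c' := count_mem false t in ct *.
  (* With [k] the deficit of tails below [n], the two weights share a common factor and differ only
     by [p^(k+1)] against [(1 - p)^k]; these compare because [p <= 1 - p] and [p <= 1]. *)
  pose k := (n - c')%N.
  have -> : c = (c' + k + k).+1 by rewrite /k; lia.
  have -> : n = (c' + k)%N by rewrite /k; lia.
  have pk : p * p ^+ k <= (1 - p) ^+ k.
    by rewrite -[leRHS]mul1r ler_pM ?exprn_ge0 ?lerXn2r ?nnegrE//; lra.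
  rewrite XMonemXE exprMn exprS !exprD.
  have A0 : 0 <= p ^+ c' * p ^+ k * (1 - p) ^+ c'.
    by rewrite !mulr_ge0 ?exprn_ge0.
  rewrite [leRHS](_ : _ = p ^+ c' * p ^+ k * (1 - p) ^+ c' * (1 - p) ^+ k).
    rewrite [leLHS](_ : _ =
      p ^+ c' * p ^+ k * (1 - p) ^+ c' * (p * p ^+ k)); last by ring.
    exact: ler_wpM2l.
  by ring.
apply: le_trans (ler_sum _ le) _.
rewrite sumr_const [in leRHS]exprMn mulrA -[leLHS]mulr_natl.
rewrite ler_wpM2r ?exprn_ge0 ?mulr_ge0//.
rewrite -natrX -natrM ler_nat.
apply: leq_trans (max_card _) _.
by rewrite card_tuple card_bool expnS -mul2n expnM.
Qed.

Lemma majority_prob_cvg0 p : 0 <= p < 2^-1 ->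
  majority_prob n p @[n --> \oo] --> 0.
Proof.
move=> /andP[p0 p2].
apply: (@squeeze_cvgr _ _ _ _ (fun=> 0)
    (geometric 2 (4 * (p * (1 - p))))).
- near=> n; rewrite majority_prob_ge0 ?majority_prob_le ?p0 ?ltW//=.
  by rewrite in_itv/=; lra.
- exact: cvg_cst.
(* The ratio [4 p (1 - p)] is below 1 because [p] is not 1/2. *)
- by apply: cvg_geometric; rewrite ltr_norml; nra.
Unshelve. all: by end_near. Qed.

Lemma majority_prob_cvg1 p : 2^-1 < p <= 1 ->
  majority_prob n p @[n --> \oo] --> (1 : R).
Proof.
move=> /andP[p2 p1].
rewrite (_ : majority_prob^~ p = fun n => 1 - majority_prob n (1 - p)).
  rewrite -[X in _ --> X](subr0 1); apply: cvgB; first exact: cvg_cst.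
  by apply: majority_prob_cvg0; lra.
by apply/funext => n; rewrite majority_prob_onem opprB addrC subrK.
Qed.

Lemma measurable_majority_prob n D : measurable_fun D (majority_prob n).
Proof.
rewrite /majority_prob; under eq_fun do rewrite -big_filter.
by apply: measurable_sum => t; exact: measurable_XMonemX.
Qed.

End Bernoulli.

(** * The game outcome read off a fixed number of rounds *)

Section draws.
Context (Omega : Type).
Variable X : nat -> Omega -> bool.

Lemma historyS k w : history X k.+1 w = rcons (history X k w) (X k w).
Proof. by rewrite /history mkseqS. Qed.

Lemma leq_count_history i k l w : (k <= l)%N ->
  (count_mem i (history X k w) <= count_mem i (history X l w))%N.
Proof.
move=> /subnKC <-; elim: (l - k)%N => [|m IH]; first by rewrite addn0.
by rewrite addnS historyS -cats1 count_cat; lia.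
Qed.

(** After [2n+1] rounds exactly one player has at least [n+1] wins, and the other cannot have
    reached [n+1] earlier since counts never decrease. *)
Lemma wins_overall_majority n :
  wins_overall X n.+1 true =
  [set w | (n < count_mem true (history X n.*2.+1 w))%N].
Proof.
move NE : n.*2.+1 => N; apply/seteqP; split => w.
all: rewrite /wins_overall /stops_at /wins /=.
all: have tot k : (count_mem true (history X k w) +
  count_mem false (history X k w) = k)%N by rewrite count_mem_bool size_mkseq.
all: have step i k : count_mem i (history X k.+1 w) =
  (count_mem i (history X k w) + (X k w == i))%N
  by rewrite historyS -cats1 count_cat /= addn0.
- move=> [[|tau]]; first by rewrite /history /=; case.
  move=> [[_ before] win].
  (* Counts start at 0 and grow by at most one per round, so never being equal to [n+1] keeps them
     at most [n]. *)
  have le i k : (k <= tau)%N -> (count_mem i (history X k w) <= n)%N.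
    elim: k => [//|k IH] ktau; have := IH (ltnW ktau).
    have := before k.+1 i ktau; rewrite !step; case: (_ == _); lia.
  (* Both counts are at most [n] after [tau] rounds, hence [tau <= 2n]. *)
  have tau_le : (tau < N)%N.
    have := le true tau (leqnn _); have := le false tau (leqnn _).
    have := tot tau; lia.
  by rewrite -win; exact: leq_count_history.
- move=> maj.
  have ex : exists k, (n < count_mem true (history X k w))%N by exists N.
  (* The stopping time is the first round count at which Player 1 exceeds [n]; a unit step makes the
     value there exactly [n+1]. *)
  case: (ex_minnP ex) => [[//|tau]] win min.
  have tau_le := min _ maj.
  have below k : (k <= tau)%N -> (count_mem true (history X k w) <= n)%N.
    by move=> kt; rewrite leqNgt; apply/negP => /min; lia.
  have reach : count_mem true (history X tau.+1 w) = n.+1.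
    by have := below _ (leqnn _); move: win; rewrite step; case: (_ == _); lia.
  exists tau.+1; split => //; split; first by exists true.
  move=> k i kt; apply/eqP; rewrite neq_ltn ltnS; apply/orP; left.
  case: i; first exact: below.
  (* Player 2 has at most [n] of the first [2n+1] rounds, hence at most [n] after any [k] up to
     there. *)
  have kN : (k <= N)%N by lia.
  apply: leq_trans (leq_count_history false _ _ w kN) _.
  rewrite -(leq_add2l (count_mem true (history X N w))) tot.
  by move: (count_mem true _) maj NE => c; lia.
Qed.

End draws.

(** * The urn as a Beta mixture of coin tosses *)

Section Polya.
Context (R : realType) (d : measure_display) (Omega : measurableType d).
Variables (P : probability Omega R) (N1 N2 : nat) (X : nat -> {RV P >-> bool}).

Lemma measurable_history (h : seq bool) :
  measurable [set w | history X (size h) w = h].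
Proof.
elim/last_ind: h => [|h i IH].
  rewrite (_ : [set _ | _] = setT)//; exact/seteqP.
rewrite (_ : [set _ | _] =
  [set w | history X (size h) w = h] `&` X (size h) @^-1` [set i]).
  apply: measurableI => //.
  by rewrite -[_ @^-1` _]setTI; exact: measurable_funP.
apply/seteqP; split => w /=; rewrite size_rcons historyS.
  by move=> /rcons_inj[].
by move=> [-> ->].
Qed.

Hypotheses (hN1 : (1 <= N1)%N) (hN2 : (1 <= N2)%N) (hX : polya_urn N1 N2 X).

(** Induction on the draws: the conditional probability of the next type is the ratio in
    [B(x+1, y) = x / (x + y) * B(x, y)], or its mirror image in [y]. *)
Lemma polya_history_prob (h : seq bool) :
  P [set w | history X (size h) w = h] =
  (beta_fun (N1 + count_mem true h) (N2 + count_mem false h) /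
   beta_fun N1 N2 : R)%:E.
Proof.
elim/last_ind: h => [|h i IH].
  rewrite /= !addn0 divff ?gt_eqF ?beta_fun_gt0// -[RHS](probability_setT P).
  by congr (P _); apply/seteqP.
rewrite (_ : [set _ | _] =
  [set w | history X (size h) w = h /\ X (size h) w = i]); last first.
  apply/seteqP; split => w /=; rewrite size_rcons historyS.
    by move=> /rcons_inj[].
  by move=> [-> ->].
rewrite hX IH -EFinM; congr EFin.
rewrite mulrAC; congr (_ / _).
rewrite /urn -!cats1 !count_cat /=.
case: i; move: (count_mem true h) (count_mem false h) => c c'.
(* Positivity of [N1] and [N2] lets the Beta values be written with factorials. *)
all: case: N1 hN1 => // a _; case: N2 hN2 => // b _.
all: rewrite /= ?addn0 ?addn1 ?addSn ?addnS !beta_fun_fact ?addSn ?addnS.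
all: rewrite [in RHS]factS [in RHS](factS (a + c + (b + c')).+1) !natrM.
all: by field; rewrite -!natrD nat1r !pnatr_eq0 -?lt0n ?fact_gt0.
Qed.

Lemma polya_event_prob N (A : pred (seq bool)) :
  P [set w | A (history X N w)] =
  \sum_(t : N.-tuple bool | A t) P [set w | history X N w = t].
Proof.
rewrite (_ : [set _ | _] =
  \bigcup_(t in [set t : N.-tuple bool | A t]) [set w | history X N w = t]).
  rewrite measure_fin_bigcup//.
  - rewrite (@bigfs _ _ _ _ (index_enum _)) ?index_enum_uniq// => t _.
    by rewrite mem_index_enum.
  - exact: finite_finset.
  - by move=> t s _ _ [w [/= e1 e2]]; apply: val_inj; rewrite /= -e1 -e2.
  - by move=> t _; rewrite -{1}(size_tuple t); exact: measurable_history.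
apply/seteqP; split => w /=.
  by move=> Aw; exists (Tuple (introT eqP (size_mkseq (X ^~ w) N))).
by move=> [t /= At ->].
Qed.

(** Each history probability is a Beta integral whose integrand splits into the prior weight and the
    coin-toss weight; the finite sum is then taken inside the integral. *)
Lemma polya_mixture N (A : pred (seq bool)) :
  P [set w | A (history X N w)] =
  ((beta_fun N1 N2)^-1%:E * \int[lebesgue_measure]_(x in `[0%R, 1%R])
    (XMonemX N1.-1 N2.-1 x * \sum_(t : N.-tuple bool | A t)
       XMonemX (count_mem true t) (count_mem false t) x)%:E)%E.
Proof.
rewrite polya_event_prob -big_filter.
under eq_bigr => t _.
  rewrite -{1}(size_tuple t) polya_history_prob mulrC EFinM EFin_beta_fun.
  over.
rewrite /= -ge0_sume_distrr; last first.
  move=> t _; apply: integral_ge0 => x _; rewrite lee_fin patchE.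
  by case: ifPn => //; rewrite inE; exact: XMonemX_ge0.
congr *%E; rewrite -ge0_integral_sum//; last 2 first.
- move=> t; apply/measurable_EFinP.
  by apply: iffLR (measurable_restrictT _ _) _ => //; exact: measurable_XMonemX.
- move=> t x _; rewrite lee_fin patchE.
  by case: ifPn => //; rewrite inE; exact: XMonemX_ge0.
rewrite [RHS]integral_mkcond; apply: eq_integral => x _.
rewrite patchE sumEFin; case: ifPn => x01.
  rewrite -big_filter mulr_sumr; congr EFin; apply: eq_bigr => t _.
  rewrite patchE x01 mulrC XMonemXM; congr (XMonemX _ _ x); lia.
by congr EFin; apply: big1 => t _; rewrite patchE (negbTE x01).
Qed.

End Polya.

(** * Dominated convergence and the limiting winning probability *)

Section limit.
Variable R : realType.
Local Notation mu := (@lebesgue_measure R).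

Lemma integral_majority_prob_cvg a b :
  (\int[mu]_(x in `[0%R, 1%R]) (XMonemX a b x * majority_prob R n x)%:E)%E
    @[n --> \oo] --> (\int[mu]_(x in `[2^-1%R, 1%R]) (XMonemX a b x)%:E)%E.
Proof.
pose f (x : R) : \bar R := (((XMonemX a b : R -> R) \_ `[2^-1, 1]) x)%:E.
have -> : (\int[mu]_(x in `[2^-1%R, 1%R]) (XMonemX a b x)%:E)%E =
    (\int[mu]_(x in `[0%R, 1%R]) f x)%E.
  rewrite [RHS](_ : _ = (\int[mu]_(x in `[0%R, 1%R])
      (((EFin \o XMonemX a b : R -> \bar R) \_ `[2^-1%R, 1%R]) x))%E);
    last by apply: eq_integral => x _; rewrite restrict_EFin.
  rewrite -integral_mkcondr; congr (integral _ _ _).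
  apply/seteqP; split => x /=; rewrite !in_itv/=; last by case.
  by move=> /andP[x2 x1]; rewrite x1 x2 andbT; split => //; lra.
have [||||||_ _] := @dominated_convergence _ _ R mu `[0, 1] _
  (fun n x => (XMonemX a b x * majority_prob R n x)%:E) f
  (EFin \o XMonemX a b).
- by [].
- move=> n; apply/measurable_EFinP; apply: measurable_funM.
    exact: measurable_XMonemX.
  exact: measurable_majority_prob.
- apply/measurable_EFinP; apply: measurable_funTS.
  by apply: iffLR (measurable_restrictT _ _) _ => //; exact: measurable_XMonemX.
(* The point 1/2 is set aside as a null set: by symmetry the majority probability stays at 1/2
   there, whereas the indicator in [f] is 1. *)
- exists [set 2^-1]; split; [by []|exact: lebesgue_measure_set1|].
  move=> x /= /not_implyP[]; rewrite in_itv/= => /andP[x0 x1].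
  apply: contra_notP => /eqP xne; apply/cvg_EFin; first exact: nearW.
  rewrite /f patchE; have := xne; rewrite neq_lt => /orP[x2|x2].
  + rewrite memNset /=; last by rewrite in_itv/=; lra.
    rewrite -[X in _ --> X](mulr0 (XMonemX a b x)).
    by apply: cvgM; [exact: cvg_cst|apply: majority_prob_cvg0; rewrite x0].
  + rewrite mem_set /=; last by rewrite in_itv/= x1 ltW.
    rewrite -[X in _ --> X](mulr1 (XMonemX a b x)).
    by apply: cvgM; [exact: cvg_cst|apply: majority_prob_cvg1; rewrite x2].
- exact: integrable_XMonemX.
(* Since the majority probability lies in [[0, 1]], the Beta weight itself dominates. *)
- apply: aeW => x n x01; rewrite /= lee_fin ger0_norm.
    by rewrite ler_piMr ?XMonemX_ge0 ?majority_prob_le1.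
  by rewrite mulr_ge0 ?XMonemX_ge0 ?majority_prob_ge0.
exact.
Qed.

End limit.

Theorem theorem3p1 (R : realType) (d : measure_display)
    (Omega : measurableType d) (P : probability Omega R) (N1 N2 : nat)
    (X : nat -> {RV P >-> bool})
    (hN1 : (1 <= N1)%N) (hN2 : (1 <= N2)%N)
    (hX : polya_urn N1 N2 X) :
  P (wins_overall X n true) @[n --> \oo] -->
  (Gamma (N1 + N2)%:R / (Gamma N1%:R * Gamma N2%:R) *
    \int[lebesgue_measure]_(x in `[0, 1])
      ((1 - x) ^+ (N2 - 1) / (2 - x) ^+ (N1 + N2)))%:E.
Proof.
rewrite [X in _ --> X](_ : _ = ((beta_fun N1 N2)^-1%:E *
  \int[lebesgue_measure]_(x in `[2^-1%R, 1%R]) (XMonemX N1.-1 N2.-1 x)%:E)%E).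
  (* The majority description concerns levels [n+1]; dropping level 0 leaves the limit unchanged. *)
  rewrite -cvg_shiftS.
  rewrite (_ : [sequence _]_n = fun n => ((beta_fun N1 N2)^-1%:E *
    \int[lebesgue_measure]_(x in `[0%R, 1%R])
      (XMonemX N1.-1 N2.-1 x * majority_prob R n x)%:E)%E).
    by apply: cvgeZl => //; exact: integral_majority_prob_cvg.
  apply/funext => n /=; rewrite wins_overall_majority.
  exact: (polya_mixture _ _ _ _ _ _ _ hN1 hN2 hX n.*2.+1
    (fun h => n < count_mem true h)%N).
(* Finiteness of the integral allows the passage from the extended-real integral to the real one of
   the statement. *)
rewrite -[X in (_ * X)%E]fineK; last first.
  apply: integrable_fin_num => //.
  apply: integrableS (integrable_XMonemX N1.-1 N2.-1) => //.
  by move=> x /=; rewrite !in_itv/=; lra.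
have := @integral_XMonemX_upper_half R N1.-1 N2.-1.
rewrite /Rintegral => ->; rewrite -EFinM; congr (_ * fine _)%:E.
  (* At positive integers the Gamma quotient is the inverse of the Beta value, both being
     factorials. *)
  case: N1 hN1 hX => // a _ _; case: N2 hN2 => // b _.
  by rewrite addSn addnS !Gamma_natS beta_fun_fact invf_div natrM.
apply: eq_integral => x _.
by case: N1 hN1 hX => // a _ _; case: N2 hN2 => // b _;
  rewrite subn1 addSn addnS.
Qed.
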